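(* Let $q\in\mathbb{C}$ with $0<|q|<1$, let $t_1,t_2$ be distinct non-zero complex numbers, and let $h_1,h_2,l_1,l_2,k_1,k_2$ be parameters. Set $\lambda=(h_1+h_2-l_1-l_2-k_1+k_2+1)/2$. Consider the equation $$(x-q^{h_1+1/2}t_1)(x-q^{h_2+1/2}t_2)g(x/q)+q^{k_1+k_2}(x-q^{l_1-1/2}t_1)(x-q^{l_2-1/2}t_2)g(qx)$$ $$-\big[(q^{k_1}+q^{k_2})x^2+Ex+p(q^{1/2}+q^{-1/2})t_1t_2\big]g(x)+(1-q^{\lambda})q^{l_1+l_2+k_1-1}t_1t_2\,x^{1-k_2}=0,\qquad(\ast)$$ where $p=q^{(h_1+h_2+l_1+l_2+k_1+k_2)/2}$ and $E=-p\{(q^{-h_2}+q^{-l_2})t_1+(q^{-h_1}+q^{-l_1})t_2\}$. (i) Let $i\in\{1,2\}$ and $i'=3-i$. The function $$g_i(x)=x^{-k_2}q^{l_i-1/2}t_i\frac{(q^{\lambda+l_i+1/2}t_i/x,\ q^{l_i-l_{i'}+1}t_i/t_{i'},\ q;q)_\infty}{(q^{l_i+1/2}t_i/x,\ q^{\lambda-h_i+l_i},\ q^{\lambda-h_{i'}+l_i}t_i/t_{i'};q)_\infty}\;{}_3\phi_2\left(\begin{array}{c}q^{l_i+1/2}t_i/x,\ q^{\lambda-h_i+l_i},\ q^{\lambda-h_{i'}+l_i}t_i/t_{i'}\\ q^{\lambda+l_i+1/2}t_i/x,\ q^{l_i-l_{i'}+1}t_i/t_{i'}\end{array};q,q\right)$$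 satisfies $(\ast)$. (ii) The function $$g_0(x)=x^{1-k_2}q^{-\lambda}\frac{(q^{-\lambda-l_1+3/2}x/t_1,\ q^{-\lambda-l_2+3/2}x/t_2,\ q;q)_\infty}{(q^{-h_1+1/2}x/t_1,\ q^{-h_2+1/2}x/t_2,\ q^{1-\lambda};q)_\infty}\;{}_3\phi_2\left(\begin{array}{c}q^{-h_1+1/2}x/t_1,\ q^{-h_2+1/2}x/t_2,\ q^{1-\lambda}\\ q^{-\lambda-l_1+3/2}x/t_1,\ q^{-\lambda-l_2+3/2}x/t_2\end{array};q,q\right)$$ satisfies $(\ast)$.
   Context: Notation: $(a;q)_\infty=\prod_{j\ge0}(1-q^ja)$, $(a_1,\dots,a_r;q)_\infty=\prod_i(a_i;q)_\infty$, $(a;q)_0=1$, $(a;q)_n=\prod_{j=0}^{n-1}(1-aq^j)$, and $${}_3\phi_2\left(\begin{array}{c}a_1,a_2,a_3\\ c_1,c_2\end{array};q,z\right)=\sum_{n\ge0}\frac{(a_1;q)_n(a_2;q)_n(a_3;q)_n}{(q;q)_n(c_1;q)_n(c_2;q)_n}z^n.$$ Powers: a branch of $\log q$ is fixed, $q^a=e^{a\log q}$, and $x^a$ is taken with a branch chosen along each orbit $\{q^nx\}_{n\in\mathbb{Z}}$ so that $(q^nx)^a=q^{na}x^a$. The statement is understood for parameter values and $x\ne0$ for which no denominator vanishes. *)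

(* Defs.v *)
From HB Require Import structures.
From mathcomp Require Import all_boot all_order all_algebra.
From mathcomp Require Import all_classical all_reals all_analysis complex.

Set Implicit Arguments.
Unset Strict Implicit.
Unset Printing Implicit Defensive.

Import Order.TTheory GRing.Theory Num.Theory.
Import numFieldNormedType.Exports.

Local Open Scope ring_scope.
Local Open Scope complex_scope.

Definition qpoch {C : numFieldType} (q a : C) (n : nat) : C :=
  \prod_(j < n) (1 - a * q ^+ j).

(* [limn] is a total operator; the limit exists whenever `|q| < 1. *)
Definition qpoch_inf {C : numFieldType} (q a : C) : C :=
  limn (fun n => qpoch q a n).

Definition qpochs_inf {C : numFieldType} (q : C) (s : seq C) : C :=
  \prod_(a <- s) qpoch_inf q a.

Definition phi32 {C : numFieldType} (q a1 a2 a3 c1 c2 z : C) : C :=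
  limn (series (fun n =>
    qpoch q a1 n * qpoch q a2 n * qpoch q a3 n /
      (qpoch q q n * qpoch q c1 n * qpoch q c2 n) * z ^+ n)).

(* The common shape of [g_i] and [g_0] below: the parameters of the products
   in front are those of the series, which is evaluated at z = q. *)
Definition nphi32 {C : numFieldType} (q a1 a2 a3 c1 c2 : C) : C :=
  qpochs_inf q [:: c1; c2; q] / qpochs_inf q [:: a1; a2; a3] *
    phi32 q a1 a2 a3 c1 c2 q.

Definition nphi32_defined {C : numFieldType} (q a1 a2 a3 c1 c2 : C) : Prop :=
  qpochs_inf q [:: a1; a2; a3] != 0 /\
  forall n, qpoch q q n * qpoch q c1 n * qpoch q c2 n != 0.

Definition cexp {R : realType} (z : R[i]) : R[i] :=
  (expR (complex.Re z) * cos (complex.Im z)) +i*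
  (expR (complex.Re z) * sin (complex.Im z)).

Section Equation.
Context {R : realType}.
Local Notation C := R[i].

(* [lq] is the chosen value of log q and [L] a choice of log x for every
   x != 0, so that q^a = qpow lq a and x^a = xpow L x a. *)
Definition qpow (lq a : C) : C := cexp (a * lq).
Definition xpow (L : C -> C) (x a : C) : C := cexp (a * L x).

Definition orbit_branch (q lq : C) (L : C -> C) : Prop :=
  forall x, x != 0 -> cexp (L x) = x /\
    forall (n : int) (a : C),
      xpow L (q ^ n * x) a = qpow lq (n%:~R * a) * xpow L x a.

(* The indices 1, 2 are the ordinals 0, 1 : 'I_2, and i' = 3 - i is
   [rev_ord i]. *)
Definition lam (h l : 'I_2 -> C) (k1 k2 : C) : C :=
  (h 0 + h 1 - l 0 - l 1 - k1 + k2 + 1) / 2.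

Definition pcoef (lq : C) (h l : 'I_2 -> C) (k1 k2 : C) : C :=
  qpow lq ((h 0 + h 1 + l 0 + l 1 + k1 + k2) / 2).

Definition Ecoef (lq : C) (t h l : 'I_2 -> C) (k1 k2 : C) : C :=
  - pcoef lq h l k1 k2 *
    ((qpow lq (- h 1) + qpow lq (- l 1)) * t 0 +
     (qpow lq (- h 0) + qpow lq (- l 0)) * t 1).

Definition satisfies_at (q lq : C) (L : C -> C) (t h l : 'I_2 -> C)
    (k1 k2 : C) (g : C -> C) (x : C) : Prop :=
  (x - qpow lq (h 0 + 1 / 2) * t 0) * (x - qpow lq (h 1 + 1 / 2) * t 1)
    * g (x / q)
  + qpow lq (k1 + k2) * (x - qpow lq (l 0 - 1 / 2) * t 0)
    * (x - qpow lq (l 1 - 1 / 2) * t 1) * g (q * x)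
  - ((qpow lq k1 + qpow lq k2) * x ^+ 2 + Ecoef lq t h l k1 k2 * x
     + pcoef lq h l k1 k2 * (qpow lq (1 / 2) + qpow lq (- (1 / 2)))
       * t 0 * t 1) * g x
  + (1 - qpow lq (lam h l k1 k2)) * qpow lq (l 0 + l 1 + k1 - 1)
    * t 0 * t 1 * xpow L x (1 - k2) = 0.

(* [F] is [nphi32] (giving the value) or [nphi32_defined] (giving the
   condition that no denominator vanishes). *)
Definition gi_args {T : Type} (F : C -> C -> C -> C -> C -> T)
    (lq : C) (t h l : 'I_2 -> C) (k1 k2 : C) (i : 'I_2) (x : C) : T :=
  let i' := rev_ord i in
  let la := lam h l k1 k2 in
  F (qpow lq (l i + 1 / 2) * t i / x)
    (qpow lq (la - h i + l i))
    (qpow lq (la - h i' + l i) * t i / t i')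
    (qpow lq (la + l i + 1 / 2) * t i / x)
    (qpow lq (l i - l i' + 1) * t i / t i').

Definition g_i (q lq : C) (L : C -> C) (t h l : 'I_2 -> C) (k1 k2 : C)
    (i : 'I_2) (x : C) : C :=
  xpow L x (- k2) * qpow lq (l i - 1 / 2) * t i *
    gi_args (nphi32 q) lq t h l k1 k2 i x.

Definition g_i_defined (q lq : C) (t h l : 'I_2 -> C) (k1 k2 : C)
    (i : 'I_2) (x : C) : Prop :=
  gi_args (nphi32_defined q) lq t h l k1 k2 i x.

Definition g0_args {T : Type} (F : C -> C -> C -> C -> C -> T)
    (lq : C) (t h l : 'I_2 -> C) (k1 k2 : C) (x : C) : T :=
  let la := lam h l k1 k2 in
  F (qpow lq (- h 0 + 1 / 2) * x / t 0)
    (qpow lq (- h 1 + 1 / 2) * x / t 1)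
    (qpow lq (1 - la))
    (qpow lq (- la - l 0 + 3 / 2) * x / t 0)
    (qpow lq (- la - l 1 + 3 / 2) * x / t 1).

Definition g_0 (q lq : C) (L : C -> C) (t h l : 'I_2 -> C) (k1 k2 : C)
    (x : C) : C :=
  xpow L x (1 - k2) * qpow lq (- lam h l k1 k2) *
    g0_args (nphi32 q) lq t h l k1 k2 x.

Definition g_0_defined (q lq : C) (t h l : 'I_2 -> C) (k1 k2 : C)
    (x : C) : Prop :=
  g0_args (nphi32_defined q) lq t h l k1 k2 x.

End Equation.

(* Main.v *)
Require Import Defs.
From mathcomp Require Import all_boot all_order all_algebra.
From mathcomp Require Import all_classical all_reals all_analysis complex.
From mathcomp Require Import ring.

Import Order.TTheory GRing.Theory Num.Theory.
Import numFieldNormedType.Exports.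

Local Open Scope classical_set_scope.
Local Open Scope ring_scope.
Local Open Scope complex_scope.

(** Write s = q^n. Since (a;q)_n = (a;q)_oo / (a s;q)_oo, the prefactor of [g_i]
    or [g_0] turns its series into a Jackson sum
      Phi = sum_n s F(s),
      F(s) = (c1 s, c2 s, q s;q)_oo / (a1 s, a2 s, a3 s;q)_oo.
    The shifts x -> x/q and x -> q x multiply some of the parameters by q or
    1/q, and this multiplies F by a rational function of s. So for suitable
    coefficients al, be, ga, independent of s, and with F^-, F^+ denoting F for
    x/q and q x,
      s (al F^- + be F^+ - ga F) = G(q s) - G(s)
    where G is F times an explicit rational function; G vanishes at s = 1 and,
    because F(0) = 1, tends to a known constant K as s -> 0. Summing over n
    gives the inhomogeneous three-term relation
      al Phi^- + be Phi^+ - ga Phi = K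
    ([nphi32_contiguous_a1c1] for [g_i], where a1 and c1 depend on x;
    [nphi32_contiguous_a1a2c1c2] for [g_0], where a1, a2, c1, c2 do).

    With the parameters of [g_i] and [g_0] put in, these relations are the
    equation up to a monomial factor ([gi_algebra], [g0_algebra]): writing all
    powers of q in terms of q^(h_j), q^(l_j), q^(k_1), q^lambda and q^(1/2),
    one has q^(k_2) = q^(2 lambda + l_1 + l_2 + k_1 - h_1 - h_2 - 1) and
    p = q^(lambda + l_1 + l_2 + k_1 - 1/2), so the comparison is an identity of
    rational functions.

    Analytically, one needs that (a;q)_n converges, to a nonzero limit when no
    factor vanishes, and that the series converges. All of this follows from
    the convergence of geometrically dominated series of complex numbers
    ([complex_geometric_complete]), which reduces to real and imaginary
    parts. *)

(** * Finite q-shifted factorials *)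

Lemma qpochS {C : numFieldType} (q a : C) n :
  qpoch q a n.+1 = qpoch q a n * (1 - a * q ^+ n).
Proof. by rewrite /qpoch big_ord_recr. Qed.

Lemma qpoch0 {C : numFieldType} (q a : C) : qpoch q a 0 = 1.
Proof. by rewrite /qpoch big_ord0. Qed.

Lemma qpochD {C : numFieldType} (q a : C) m n :
  qpoch q a (m + n) = qpoch q a m * qpoch q (a * q ^+ m) n.
Proof.
elim: n => [|n IH]; first by rewrite addn0 qpoch0 mulr1.
by rewrite addnS !qpochS IH exprD !mulrA.
Qed.

(** One estimate serves for upper bounds (at most 3/2) and for lower bounds (at
    least 1/2) of all partial products, hence for the convergence and for the
    nonvanishing of the infinite product. *)
Lemma qpoch_near1 {C : numFieldType} (q a : C) (n : nat) :
  `|q| < 1 -> `|a| <= (1 - `|q|) / 4 -> `|qpoch q a n - 1| <= 1 / 2.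
Proof.
move=> q1 ha.
have dq : 0 < 1 - `|q| by rewrite subr_gt0.
have dn : 1 - `|q| != 0 by rewrite gt_eqF.
(* The right-hand side is twice the sum over j < n of the bound
   (1 - `|q|) / 4 * `|q| ^+ j for `|a * q ^+ j|. *)
suff H : `|qpoch q a n - 1| <= (1 - `|q| ^+ n) / 2.
  by apply: le_trans H _; rewrite ler_pM2r ?invr_gt0 ?ltr0n //.
elim: n => [|n IH]; first by rewrite qpoch0 subrr normr0 mul0r.
have -> : qpoch q a n.+1 - 1 = (qpoch q a n - 1) + - (qpoch q a n * (a * q ^+ n)).
  by rewrite qpochS; ring.
have P2 : `|qpoch q a n| <= 2.
  rewrite -[qpoch q a n](subrK 1); apply: le_trans (ler_normD _ _) _.
  rewrite normr1 -[leRHS]/(1 + 1) lerD2r; apply: le_trans IH _.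
  by rewrite ler_pdivrMr ?ltr0n // mul1r (le_trans (_ : _ <= 1)) ?ler1n //.
apply: le_trans (ler_normD _ _) _; rewrite normrN !normrM normrX.
apply: (@le_trans _ _ ((1 - `|q| ^+ n) / 2 + 2 * ((1 - `|q|) / 4 * `|q| ^+ n))).
  apply: lerD => //; apply: ler_pM => //.
  by rewrite ler_wpM2r.
by rewrite le_eqVlt exprS; apply/orP; left; apply/eqP; field.
Qed.

(** The shifted product (a q^n; q)_oo, when (a;q)_n is nonzero. The quotient
    form makes the prefactor of the series appear without further work. *)
Definition qtail {C : numFieldType} (q a : C) (n : nat) : C :=
  qpoch_inf q a / qpoch q a n.

(** The function F(s) of the introduction at s = q^n: the n-th term of the
    normalized series without its factor q^n. *)
Definition nterm {C : numFieldType} (q a1 a2 a3 c1 c2 : C) (n : nat) : C :=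
  qtail q c1 n * qtail q c2 n * qtail q q n /
  (qtail q a1 n * qtail q a2 n * qtail q a3 n).

Lemma qtailS {C : numFieldType} (q a : C) n :
  qtail q a n.+1 = qtail q a n / (1 - a * q ^+ n).
Proof. by rewrite /qtail qpochS invfM mulrA. Qed.

Lemma ntermS {C : numFieldType} (q a1 a2 a3 c1 c2 : C) n :
  nterm q a1 a2 a3 c1 c2 n.+1 = nterm q a1 a2 a3 c1 c2 n *
    ((1 - a1 * q ^+ n) * (1 - a2 * q ^+ n) * (1 - a3 * q ^+ n) /
     ((1 - c1 * q ^+ n) * (1 - c2 * q ^+ n) * (1 - q * q ^+ n))).
Proof. by rewrite /nterm !qtailS !invfM !invrK; ring. Qed.

(** * Convergence of infinite products *)

(** All that is used about the completeness of the base field. It lets the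
    theory be stated over an abstract [numFieldType], which carries a topology. *)
Definition geometric_complete (C : numFieldType) :=
  forall (q M : C) (u : C^nat), `|q| < 1 ->
  (forall n, `|u n| <= M * `|q| ^+ n) -> cvgn (series u).

Section Convergence.
Context {R : realType}.
(* The topology of [R[i]] is attached to its [numFieldType] structure. *)
Let C : numFieldType := R[i].

Lemma cvg_real_complex (u : R^nat) (a : R) :
  u @ \oo --> a -> ((u n)%:C : C) @[n --> \oo] --> (a%:C : C).
Proof.
move=> /cvgrPdist_lt hu; apply/cvgrPdist_lt => e.
rewrite ltcE /= => /andP[/eqP ei e0].
have -> : e = (complex.Re e)%:C by case: e ei {e0} => er em /= ->.
near=> n; rewrite -rmorphB normc_def /= expr0n addr0 ltcR sqrtr_sqr.
by near: n; exact: hu.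
Unshelve. all: end_near. Qed.

(** Real and imaginary parts are bounded by the modulus, so both are dominated
    by the same real geometric series. *)
Lemma complex_geometric_complete : geometric_complete C.
Proof.
move=> q M u q1 hu.
have reN (z : C) : `|z| = (complex.Re `|z|)%:C by rewrite normc_def.
set r := complex.Re `|q|.
have r1 : `|r| < 1.
  rewrite ger0_norm; first by move: q1; rewrite reN ltcR.
  rewrite -(lecR 0) /r -reN; exact: normr_ge0.
set v := geometric (complex.Re M) r.
have M0 : 0 <= M by have := hu 0; rewrite expr0 mulr1; exact: le_trans.
have ME : M = (complex.Re M)%:C by rewrite -(ger0_norm M0) normc_def.
have huv n : complex.Re `|u n| <= v n.
  rewrite -lecR -reN /v /= rmorphM rmorphXn /= -ME /r -reN; exact: hu.
have part (f : C -> R) : (forall z, `|f z| <= complex.Re `|z|) ->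
    cvgn (series (f \o u)).
  move=> hf; apply: normed_cvg; apply: (@series_le_cvg _ _ v).
  - by move=> n; rewrite /=.
  - by move=> n; rewrite /v /= (le_trans _ (huv n)) // -lecR -reN; exact: normr_ge0.
  - by move=> n; rewrite /= (le_trans (hf _)).
  - exact: is_cvg_geometric_series.
have cRe : cvgn (series ((@complex.Re R) \o u)).
  apply: part => z; rewrite normc_def /= -[leLHS]sqrtr_sqr.
  by rewrite ler_wsqrtr // lerDl sqr_ge0.
have cIm : cvgn (series ((@complex.Im R) \o u)).
  apply: part => z; rewrite normc_def /= -[leLHS]sqrtr_sqr.
  by rewrite ler_wsqrtr // lerDr sqr_ge0.
have -> : series u = fun n =>
   ((series ((@complex.Re R) \o u) n)%:C + 'i * (series ((@complex.Im R) \o u) n)%:C).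
  apply/funext => n; rewrite !seriesEnat /= !rmorph_sum mulr_sumr -big_split /=.
  by apply: eq_bigr => j _; rewrite -complexE.
apply: is_cvgD; first by apply/cvg_ex; eexists; exact: cvg_real_complex cRe.
apply: is_cvgM; first exact: is_cvg_cst.
by apply/cvg_ex; eexists; exact: cvg_real_complex cIm.
Qed.

End Convergence.

Section InfiniteProducts.
Context (C : numFieldType) (hC : geometric_complete C).

Lemma cvg_exprn0 (q : C) : `|q| < 1 -> q ^+ n @[n --> \oo] --> (0 : C).
Proof.
move=> q1; apply: cvg_series_cvg_0.
by apply: (@hC q 1) => // n; rewrite normrX mul1r.
Qed.

Lemma cvg_series_exprnM (q : C) (u : C^nat) :
  `|q| < 1 -> cvgn u -> cvgn (series (fun n => q ^+ n * u n)).
Proof.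
move=> q1 /cvg_seq_bounded [M [Mr HM]].
apply: (@hC q (`|M| + 1)) => // n.
rewrite normrM normrX mulrC; apply: ler_wpM2r; first exact: exprn_ge0.
apply: HM => //.
by rewrite (le_lt_trans (real_ler_norm Mr)) // ltrDl.
Qed.

(** From some index on, the tail (a q^N; q)_n of the product is covered by
    [qpoch_near1]. *)
Lemma exprn_tail_small (q a : C) :
  `|q| < 1 -> exists N, `|a * q ^+ N| <= (1 - `|q|) / 4.
Proof.
move=> q1; have dq : 0 < 1 - `|q| by rewrite subr_gt0.
have : a * q ^+ n @[n --> \oo] --> (a * 0 : C).
  by apply: cvgM; [exact: cvg_cst | exact: cvg_exprn0].
rewrite mulr0 => /cvgrPdist_le /(_ ((1 - `|q|) / 4)).
case; first by rewrite divr_gt0 // ltr0n.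
by move=> N _ /(_ N (leqnn N)) /=; rewrite sub0r normrN; exists N.
Qed.

(** The bounded partial products of the tail have geometrically dominated
    increments. *)
Lemma is_cvg_qpoch (q a : C) : `|q| < 1 -> cvgn (qpoch q a).
Proof.
move=> q1; have [N hN] := exprn_tail_small q a q1.
set b := a * q ^+ N in hN; have Eb : a * q ^+ N = b by []; clearbody b.
have /cvg_ex [y cy] : cvgn (qpoch q b).
  have -> : qpoch q b = (fun n => 1 + series (telescope (qpoch q b)) n).
    by apply/funext => n; rewrite {1}[LHS]eq_sum_telescope qpoch0.
  apply: is_cvgD; first exact: is_cvg_cst.
  apply: (@hC q (2 * `|b|)) => // n.
  rewrite /telescope /= qpochS.
  have -> : qpoch q b n * (1 - b * q ^+ n) - qpoch q b n =
            - (qpoch q b n * (b * q ^+ n)) by ring.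
  rewrite normrN !normrM (normrX n q) !mulrA.
  apply: ler_wpM2r; first exact: exprn_ge0.
  apply: ler_wpM2r => //.
  rewrite -[qpoch q b n](subrK 1); apply: le_trans (ler_normD _ _) _.
  rewrite normr1 -[leRHS]/(1 + 1) lerD2r.
  apply: le_trans (qpoch_near1 q b n q1 hN) _.
  by rewrite ler_pdivrMr ?ltr0n // mul1r ler1n.
apply/cvg_ex; exists (qpoch q a N * y).
rewrite -(cvg_shiftn N).
have -> : [sequence qpoch q a (n + N)]_n = (fun n => qpoch q a N * qpoch q b n).
  by apply/funext => n; rewrite /= addnC qpochD Eb.
by apply: cvgM => //; exact: cvg_cst.
Qed.

Lemma qpoch_inf_cvg (q a : C) : `|q| < 1 -> qpoch q a @ \oo --> qpoch_inf q a.
Proof. exact: is_cvg_qpoch. Qed.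

(** The partial products of a tail stay at least 1/2 in modulus. *)
Lemma qpoch_inf_neq0 (q a : C) : `|q| < 1 ->
  (forall n, qpoch q a n != 0) -> qpoch_inf q a != 0.
Proof.
move=> q1 h0; have [N hN] := exprn_tail_small q a q1.
apply/eqP => z; have := qpoch_inf_cvg q a q1.
rewrite z => /cvgrPdist_lt /(_ (`|qpoch q a N| / 2)).
case; first by rewrite divr_gt0 ?normr_gt0 ?ltr0n.
move=> M _ /(_ (N + M)%N (leq_addl _ _)) /=.
rewrite sub0r normrN qpochD normrM ltr_pM2l ?normr_gt0 // => h.
have := qpoch_near1 _ _ M q1 hN; rewrite -normrN opprB.
have : `|1 : C| <= `|1 - qpoch q (a * q ^+ N) M| + `|qpoch q (a * q ^+ N) M|.
  by rewrite -{1}(subrK (qpoch q (a * q ^+ N) M) 1) ler_normD.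
rewrite normr1 => h1 h2.
have := le_lt_trans h1 (ler_ltD h2 h).
by rewrite (_ : 1 / 2 + 2^-1 = 1) ?ltxx //; field.
Qed.

Lemma qpoch_infD (q a : C) n : `|q| < 1 ->
  qpoch_inf q a = qpoch q a n * qpoch_inf q (a * q ^+ n).
Proof.
move=> q1; apply: cvg_lim => //.
rewrite -(cvg_shiftn n).
have -> : [sequence qpoch q a (m + n)]_m =
    (fun m => qpoch q a n * qpoch q (a * q ^+ n) m).
  by apply/funext => m; rewrite /= addnC qpochD.
by apply: cvgM; [exact: cvg_cst | exact: qpoch_inf_cvg].
Qed.

(** * The normalized series as a Jackson sum *)

Context (q : C) (q1 : `|q| < 1).

Lemma qtail_shift (a : C) n : 1 - a != 0 ->
  qtail q (q * a) n = qtail q a n / (1 - a * q ^+ n).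
Proof.
move=> a1.
have P1 : qpoch q a 1 = 1 - a by rewrite qpochS qpoch0 mul1r expr0 mulr1.
have := qpochD q a 1 n; rewrite add1n P1 expr1 => PS.
rewrite -qtailS /qtail (qpoch_infD q a 1) // PS P1 expr1 (mulrC q).
by rewrite invfM mulrACA divff // mul1r.
Qed.

Lemma qtail_cvg1 (a : C) : (forall n, qpoch q a n != 0) ->
  qtail q a @ \oo --> (1 : C).
Proof.
move=> h; have h0 := qpoch_inf_neq0 q a q1 h.
rewrite -(divff h0); apply: cvgM; first exact: cvg_cst.
by apply: cvgV => //; exact: qpoch_inf_cvg.
Qed.

Lemma qtail_unshift (a : C) n : q != 0 -> 1 - a / q != 0 ->
  1 - a / q * q ^+ n != 0 ->
  qtail q (a / q) n = qtail q a n * (1 - a / q * q ^+ n).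
Proof.
move=> q0 h0 hn; have := qtail_shift (a / q) n h0.
by rewrite (mulrC q) divfK // => ->; rewrite divfK.
Qed.

Lemma qpoch_neq0_factor (a : C) n : (forall m, qpoch q a m != 0) ->
  1 - a * q ^+ n != 0.
Proof. by move=> /(_ n.+1); rewrite qpochS mulf_eq0 negb_or => /andP[]. Qed.

(** For the upper parameters the definition speaks of (a;q)_oo, which has every
    (a;q)_n as a factor. *)
Lemma nphi32_definedP (a1 a2 a3 c1 c2 : C) : nphi32_defined q a1 a2 a3 c1 c2 ->
  forall b, b \in [:: a1; a2; a3; c1; c2; q] -> forall n, qpoch q b n != 0.
Proof.
case; rewrite /qpochs_inf !big_cons big_nil mulr1 !mulf_eq0 !negb_or.
case/and3P=> i1 i2 i3 h b.
have inf (a : C) n : qpoch_inf q a != 0 -> qpoch q a n != 0.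
  by rewrite (qpoch_infD q a n) // mulf_eq0 negb_or => /andP[].
rewrite !inE => hb n; have := h n; rewrite !mulf_eq0 !negb_or -andbA.
by case/and3P=> *; case/or4P: hb => [||| /or3P[]] /eqP -> //; apply: inf.
Qed.

Lemma nphi32_defined_factor (a1 a2 a3 c1 c2 b : C) n :
  nphi32_defined q a1 a2 a3 c1 c2 -> b \in [:: a1; a2; a3; c1; c2; q] ->
  1 - b * q ^+ n != 0.
Proof.
by move=> /nphi32_definedP h hb; apply: qpoch_neq0_factor => m; exact: h.
Qed.

(** The quotient of the finite products converges, because the limit of its
    denominator is nonzero; so the terms are O(q^n). *)
Lemma nphi32_cvg (a1 a2 a3 c1 c2 : C) : nphi32_defined q a1 a2 a3 c1 c2 ->
  series (fun n => q ^+ n * nterm q a1 a2 a3 c1 c2 n) @ \oo -->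
    nphi32 q a1 a2 a3 c1 c2.
Proof.
move=> /nphi32_definedP h.
pose u n := qpoch q a1 n * qpoch q a2 n * qpoch q a3 n /
            (qpoch q q n * qpoch q c1 n * qpoch q c2 n).
pose P := qpochs_inf q [:: c1; c2; q] / qpochs_inf q [:: a1; a2; a3].
have cP b : qpoch q b @ \oo --> qpoch_inf q b by exact: qpoch_inf_cvg.
have cu : cvgn u.
  apply: is_cvgM.
    by do ?apply: is_cvgM; apply/cvg_ex; eexists; exact: cP.
  apply/cvg_ex; eexists; apply: cvgV; last first.
    by apply: cvgM; [apply: cvgM|]; exact: cP.
  by rewrite !mulf_neq0 // qpoch_inf_neq0 // => n; apply: h; rewrite !inE eqxx ?orbT.
have -> : (fun n => q ^+ n * nterm q a1 a2 a3 c1 c2 n) =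
          (fun n => P * (u n * q ^+ n)).
  apply/funext => n; rewrite /nterm /qtail /P /u /qpochs_inf.
  by rewrite !big_cons big_nil !mulr1 !invfM !invrK; ring.
have -> : series (fun n => P * (u n * q ^+ n)) =
          (fun n => P * series (fun n => u n * q ^+ n) n).
  by apply/funext => n; rewrite !seriesEnat /= mulr_sumr.
apply: cvgM; first exact: cvg_cst.
have := cvg_series_exprnM q u q1 cu.
by under eq_fun do rewrite mulrC.
Qed.

Lemma nterm_cvg1 (a1 a2 a3 c1 c2 : C) : nphi32_defined q a1 a2 a3 c1 c2 ->
  nterm q a1 a2 a3 c1 c2 @ \oo --> (1 : C).
Proof.
move=> /nphi32_definedP h.
have t b : b \in [:: a1; a2; a3; c1; c2; q] -> qtail q b @ \oo --> (1 : C).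
  by move=> hb; apply: qtail_cvg1; exact: h.
have {1}-> : (1 : C) = 1 * 1 * 1 / (1 * 1 * 1) by rewrite !mulr1 divr1.
have tM b1 b2 b3 : [&& b1 \in [:: a1; a2; a3; c1; c2; q],
    b2 \in [:: a1; a2; a3; c1; c2; q] & b3 \in [:: a1; a2; a3; c1; c2; q]] ->
    (fun n => qtail q b1 n * qtail q b2 n * qtail q b3 n) @ \oo --> (1 * 1 * 1 : C).
  by case/and3P=> *; apply: cvgM; [apply: cvgM|]; exact: t.
apply: cvgM; first by apply: tM; rewrite !inE !eqxx !orbT.
apply: cvgV; first by rewrite !mulr1 oner_eq0.
by apply: tM; rewrite !inE !eqxx !orbT.
Qed.

Lemma telescope_cvg (u G : C^nat) (S K : C) :
  (forall n, u n = G n.+1 - G n) -> G 0%N = 0 ->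
  series u @ \oo --> S -> G @ \oo --> K -> S = K.
Proof.
move=> hu G0 cS cK; have E : series u = G.
  have -> : u = telescope G by apply/funext.
  by rewrite telescopeK; apply/funext => n; rewrite /= G0 subr0.
by rewrite E in cS; apply: cvg_unique cS cK.
Qed.

(** * Contiguous relations *)

Lemma series_three_cvg (Fm F Fp : C^nat) (al be ga : C) (Sm S Sp : C) :
  series (fun n => q ^+ n * Fm n) @ \oo --> Sm ->
  series (fun n => q ^+ n * F n) @ \oo --> S ->
  series (fun n => q ^+ n * Fp n) @ \oo --> Sp ->
  series (fun n => q ^+ n * (al * Fm n + be * Fp n - ga * F n)) @ \oo -->
    al * Sm + be * Sp - ga * S.
Proof.
move=> cm c cp.
have -> : series (fun n => q ^+ n * (al * Fm n + be * Fp n - ga * F n)) =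
   (fun n => al * series (fun n => q ^+ n * Fm n) n
           + be * series (fun n => q ^+ n * Fp n) n
           - ga * series (fun n => q ^+ n * F n) n).
  apply/funext => n; rewrite !seriesEnat /= !mulr_sumr -!big_split -sumrB /=.
  by apply: eq_bigr => j _; ring.
by apply: cvgB; [apply: cvgD|]; (apply: cvgM; [exact: cvg_cst|]).
Qed.

Lemma cvg_exprnM0 (u : C^nat) (l : C) : u @ \oo --> l ->
  (fun n => q ^+ n * u n) @ \oo --> (0 : C).
Proof. by move=> cu; rewrite -(mul0r l); apply: cvgM => //; exact: cvg_exprn0. Qed.

(** In [g_i] the parameters a1 and c1 are proportional to 1/x, so x/q gives q a1
    and q c1. The telescoping function is
      G(s) = (c1 - a1) (1 - s) (1 - c2 s/q) / (1 - a1 s/q) F(s).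
    After clearing denominators G(q s) - G(s) is a cubic polynomial in s
    without constant term; comparing it with the left-hand side at s = 1/c1
    gives [al], at s = q/a1 gives [be], and the coefficient of s gives [ga]. *)
Lemma nphi32_contiguous_a1c1 (a1 a2 a3 c1 c2 : C) : q != 0 ->
  nphi32_defined q (q * a1) a2 a3 (q * c1) c2 ->
  nphi32_defined q a1 a2 a3 c1 c2 ->
  nphi32_defined q (a1 / q) a2 a3 (c1 / q) c2 ->
  let al := (c1 - a2) * (c1 - a3) in
  let be := (a1 - q) * (a1 - c2) / q in
  let ga := al + be - (c1 - a1) * (1 + c1 + c2 / q - a1 / q - a2 - a3) in
  al * nphi32 q (q * a1) a2 a3 (q * c1) c2
  + be * nphi32 q (a1 / q) a2 a3 (c1 / q) c2
  - ga * nphi32 q a1 a2 a3 c1 c2 = c1 - a1.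
Proof.
move=> q0 dm d dp al be ga.
have f := nphi32_defined_factor _ _ _ _ _ _ _ d.
have fp := nphi32_defined_factor _ _ _ _ _ _ _ dp.
have fa1 n : 1 - a1 * q ^+ n != 0 by apply: f; rewrite !inE eqxx ?orbT.
have fc1 n : 1 - c1 * q ^+ n != 0 by apply: f; rewrite !inE eqxx ?orbT.
have fc2 n : 1 - c2 * q ^+ n != 0 by apply: f; rewrite !inE eqxx ?orbT.
have fq n : 1 - q * q ^+ n != 0 by apply: f; rewrite !inE eqxx ?orbT.
have fa1q n : 1 - a1 / q * q ^+ n != 0 by apply: fp; rewrite !inE eqxx ?orbT.
have fc1q n : 1 - c1 / q * q ^+ n != 0 by apply: fp; rewrite !inE eqxx ?orbT.
pose F := nterm q a1 a2 a3 c1 c2.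
have Fm n : nterm q (q * a1) a2 a3 (q * c1) c2 n =
    F n * (1 - a1 * q ^+ n) / (1 - c1 * q ^+ n).
  rewrite /F /nterm !qtail_shift; last 2 first.
  - by have := fa1 0; rewrite expr0 mulr1.
  - by have := fc1 0; rewrite expr0 mulr1.
  by rewrite !invfM !invrK; ring.
have Fp n : nterm q (a1 / q) a2 a3 (c1 / q) c2 n =
    F n * (1 - c1 / q * q ^+ n) / (1 - a1 / q * q ^+ n).
  rewrite /F /nterm !qtail_unshift //; last 2 first.
  - by have := fa1q 0; rewrite expr0 mulr1.
  - by have := fc1q 0; rewrite expr0 mulr1.
  by rewrite !invfM; ring.
pose G n := (c1 - a1) * (1 - q ^+ n) * (1 - c2 / q * q ^+ n) /
            (1 - a1 / q * q ^+ n) * F n.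
have cs := series_three_cvg _ _ _ al be ga _ _ _ (nphi32_cvg _ _ _ _ _ dm)
  (nphi32_cvg _ _ _ _ _ d) (nphi32_cvg _ _ _ _ _ dp).
apply: (telescope_cvg _ G _ _ _ _ cs).
- move=> n; rewrite Fm Fp /G (ntermS _ _ _ _ _ _ n : F n.+1 = _) -/(F n).
  have := fa1 n; have := fc1 n; have := fc2 n; have := fq n; have := fa1q n.
  rewrite exprS (mulrA (a1 / q)) divfK // /ga /al /be.
  move: (q ^+ n) (F n) => s y e1 e2 e3 e4 e5.
  field; rewrite q0 e2 e3 e4 e5 !andbT /=.
  have -> : q - a1 * s = q * (1 - a1 / q * s) by field.
  by rewrite mulf_neq0.
- by rewrite /G expr0 subrr mulr0 !mul0r.
rewrite [X in _ --> X](_ : _ =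
  (c1 - a1) * (1 - 0) * (1 - c2 / q * 0) / (1 - a1 / q * 0) * 1); last first.
  by rewrite !mulr0 !subr0 divr1 !mulr1.
have s0 : q ^+ n @[n --> \oo] --> (0 : C) by exact: cvg_exprn0.
have lin (x : C) : (fun n => 1 - x * q ^+ n) @ \oo --> (1 - x * 0 : C).
  by apply: cvgB; [exact: cvg_cst | apply: cvgM => //; exact: cvg_cst].
apply: cvgM; last exact: nterm_cvg1.
apply: cvgM; last by apply: cvgV => //; rewrite mulr0 subr0 oner_eq0.
apply: cvgM; last exact: lin.
apply: cvgM; first exact: cvg_cst.
by apply: cvgB => //; exact: cvg_cst.
Qed.

(** The varying parameters enter F through a1 s, a2 s, c1 s, c2 s, so F^- at q s,
    F at s and F^+ at s/q differ only in the factors with a3 and q. In that form the telescoping function is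
      (1 - a3/q) (1 - c1 s/q) (1 - c2 s/q) / (1 - a3 s/q) F(s),
    and [al], [be], [ga] are found as in the previous relation. Undoing the two
    index shifts gives
      G(s) = (1 - a3/q + m s) F(s) - al s F^-(s),
      m = (a3 - c1 - c2 + c1 c2/q) / q,
    which has no denominator 1 - a3 s/q; at s = 1 the first term is
    (1 - c1/q) (1 - c2/q) F(1), and it cancels against the second. *)
Lemma nphi32_contiguous_a1a2c1c2 (a1 a2 a3 c1 c2 : C) : q != 0 ->
  nphi32_defined q (a1 / q) (a2 / q) a3 (c1 / q) (c2 / q) ->
  nphi32_defined q a1 a2 a3 c1 c2 ->
  nphi32_defined q (q * a1) (q * a2) a3 (q * c1) (q * c2) ->
  let al := (1 - a1 / q) * (1 - a2 / q) in
  let be := (a3 - c1) * (a3 - c2) / q in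
  let ga := al * q + be / q
            - (1 - a3 / q) * (q + c1 / q + c2 / q - a1 - a2 - a3 / q) in
  al * nphi32 q (a1 / q) (a2 / q) a3 (c1 / q) (c2 / q)
  + be * nphi32 q (q * a1) (q * a2) a3 (q * c1) (q * c2)
  - ga * nphi32 q a1 a2 a3 c1 c2 = 1 - a3 / q.
Proof.
move=> q0 dm d dp al be ga.
have f := nphi32_defined_factor _ _ _ _ _ _ _ d.
have fm := nphi32_defined_factor _ _ _ _ _ _ _ dm.
have fa1 n : 1 - a1 * q ^+ n != 0 by apply: f; rewrite !inE eqxx ?orbT.
have fa2 n : 1 - a2 * q ^+ n != 0 by apply: f; rewrite !inE eqxx ?orbT.
have fc1 n : 1 - c1 * q ^+ n != 0 by apply: f; rewrite !inE eqxx ?orbT.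
have fc2 n : 1 - c2 * q ^+ n != 0 by apply: f; rewrite !inE eqxx ?orbT.
have fq n : 1 - q * q ^+ n != 0 by apply: f; rewrite !inE eqxx ?orbT.
have fa1q n : 1 - a1 / q * q ^+ n != 0 by apply: fm; rewrite !inE eqxx ?orbT.
have fa2q n : 1 - a2 / q * q ^+ n != 0 by apply: fm; rewrite !inE eqxx ?orbT.
have fc1q n : 1 - c1 / q * q ^+ n != 0 by apply: fm; rewrite !inE eqxx ?orbT.
have fc2q n : 1 - c2 / q * q ^+ n != 0 by apply: fm; rewrite !inE eqxx ?orbT.
have at0 b : (forall n, 1 - b * q ^+ n != 0) -> 1 - b != 0.
  by move=> /(_ 0%N); rewrite expr0 mulr1.
pose F := nterm q a1 a2 a3 c1 c2.
have Fm n : nterm q (a1 / q) (a2 / q) a3 (c1 / q) (c2 / q) n =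
    F n * ((1 - c1 / q * q ^+ n) * (1 - c2 / q * q ^+ n)) /
          ((1 - a1 / q * q ^+ n) * (1 - a2 / q * q ^+ n)).
  by rewrite /F /nterm !qtail_unshift // ?(at0 _ fa1q, at0 _ fa2q, at0 _ fc1q, at0 _ fc2q) //
    !invfM; ring.
have Fp n : nterm q (q * a1) (q * a2) a3 (q * c1) (q * c2) n =
    F n * ((1 - a1 * q ^+ n) * (1 - a2 * q ^+ n)) /
          ((1 - c1 * q ^+ n) * (1 - c2 * q ^+ n)).
  by rewrite /F /nterm !qtail_shift ?(at0 _ fa1, at0 _ fa2, at0 _ fc1, at0 _ fc2) //
    !invfM !invrK; ring.
pose m := (a3 - c1 - c2 + c1 * c2 / q) / q.
pose G n := (1 - a3 / q + m * q ^+ n) * F n -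
  al * (q ^+ n * nterm q (a1 / q) (a2 / q) a3 (c1 / q) (c2 / q) n).
have cs := series_three_cvg _ _ _ al be ga _ _ _ (nphi32_cvg _ _ _ _ _ dm)
  (nphi32_cvg _ _ _ _ _ d) (nphi32_cvg _ _ _ _ _ dp).
apply: (telescope_cvg _ G _ _ _ _ cs).
- move=> n; rewrite /G !Fm Fp (ntermS _ _ _ _ _ _ n : F n.+1 = _) -/(F n).
  have := fa1 n; have := fa2 n; have := fc1 n; have := fc2 n; have := fq n.
  have := fa1q n; have := fa2q n.
  rewrite exprS (mulrA (a1 / q)) (mulrA (a2 / q)) (mulrA (c1 / q))
    (mulrA (c2 / q)) !(divfK q0) /ga /al /be /m.
  move: (q ^+ n) (F n) => s y e1 e2 e3 e4 e5 e6 e7.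
  field; rewrite q0 e3 e4 e5 e6 e7 !andbT /=.
  have -> : q - a1 * s = q * (1 - a1 / q * s) by field.
  have -> : q - a2 * s = q * (1 - a2 / q * s) by field.
  by rewrite !mulf_neq0.
- have := at0 _ fa1q; have := at0 _ fa2q => h2 h1.
  rewrite /G Fm expr0 !mulr1 mul1r /m /al.
  field; rewrite q0 /=.
  have -> : q - a1 = q * (1 - a1 / q) by field.
  have -> : q - a2 = q * (1 - a2 / q) by field.
  by rewrite !mulf_neq0.
rewrite [X in _ --> X](_ : _ = (1 - a3 / q + m * 0) * 1 - al * 0); last first.
  by rewrite !mulr0 addr0 subr0 mulr1.
have s0 : q ^+ n @[n --> \oo] --> (0 : C) by exact: cvg_exprn0.
apply: cvgB.
  apply: cvgM; last exact: nterm_cvg1.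
  by apply: cvgD; [exact: cvg_cst | apply: cvgM => //; exact: cvg_cst].
apply: cvgM; first exact: cvg_cst.
exact: cvg_exprnM0 (nterm_cvg1 _ _ _ _ _ dm).
Qed.

End InfiniteProducts.

(** * The contiguous relations as q-difference equations *)

(** The equation is the contiguous relation times
    K1 L' u x^2 X / Q^3. Here Q, H, L, K1, K2, La stand for q^(1/2), q^(h_i),
    q^(l_i), q^(k_1), q^(k_2), q^lambda, a prime for the other index, and X for
    x^(-k_2). *)
Lemma gi_algebra {F : fieldType} (x X t u H H' L L' K1 K2 La Q q pm p0 pp : F) :
  x != 0 -> t != 0 -> u != 0 -> H != 0 -> H' != 0 -> L != 0 -> L' != 0 ->
  K1 != 0 -> La != 0 -> Q != 0 ->
  Q ^+ 2 = q -> K2 = La ^+ 2 * L * L' * K1 / (H * H' * Q ^+ 2) ->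
  let p := La * L * L' * K1 / Q in
  let a1 := L * Q * t / x in
  let a2 := La / H * L in
  let a3 := La / H' * L * t / u in
  let c1 := La * L * Q * t / x in
  let c2 := L / L' * q * t / u in
  let al := (c1 - a2) * (c1 - a3) in
  let be := (a1 - q) * (a1 - c2) / q in
  let ga := al + be - (c1 - a1) * (1 + c1 + c2 / q - a1 / q - a2 - a3) in
  al * pm + be * pp - ga * p0 = c1 - a1 ->
  (x - H * Q * t) * (x - H' * Q * u) * (K2 * X * (L / Q) * t * pm)
  + K1 * K2 * (x - L / Q * t) * (x - L' / Q * u) * (K2^-1 * X * (L / Q) * t * pp)
  - ((K1 + K2) * x ^+ 2 + - p * ((H'^-1 + L'^-1) * t + (H^-1 + L^-1) * u) * x
     + p * (Q + Q^-1) * t * u) * (X * (L / Q) * t * p0)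
  + (1 - La) * (L * L' * K1 / q) * t * u * (x * X) = 0.
Proof.
move=> x0 t0 u0 H0 H'0 L0 L'0 K0 La0 Q0 hq hK p a1 a2 a3 c1 c2 al be ga h.
transitivity (K1 * L' * u * x ^+ 2 * X / Q ^+ 3 *
  (al * pm + be * pp - ga * p0 - (c1 - a1))); last by rewrite h subrr mulr0.
rewrite /ga /al /be /c1 /c2 /a1 /a2 /a3 /p hK -hq.
by field; rewrite ?x0 ?t0 ?u0 ?H0 ?H'0 ?L0 ?L'0 ?K0 ?La0 ?Q0.
Qed.

(** In the same notation, the equation is the contiguous relation times
    La L L' K1 t u x X / Q^2. *)
Lemma g0_algebra {F : fieldType} (x X t u H H' L L' K1 K2 La Q q pm p0 pp : F) :
  x != 0 -> t != 0 -> u != 0 -> H != 0 -> H' != 0 -> L != 0 -> L' != 0 ->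
  K1 != 0 -> La != 0 -> Q != 0 ->
  Q ^+ 2 = q -> K2 = La ^+ 2 * L * L' * K1 / (H * H' * Q ^+ 2) ->
  let p := La * L * L' * K1 / Q in
  let a1 := H^-1 * Q * x / t in
  let a2 := H'^-1 * Q * x / u in
  let a3 := q / La in
  let c1 := La^-1 / L * Q ^+ 3 * x / t in
  let c2 := La^-1 / L' * Q ^+ 3 * x / u in
  let al := (1 - a1 / q) * (1 - a2 / q) in
  let be := (a3 - c1) * (a3 - c2) / q in
  let ga := al * q + be / q
            - (1 - a3 / q) * (q + c1 / q + c2 / q - a1 - a2 - a3 / q) in
  al * pm + be * pp - ga * p0 = 1 - a3 / q ->
  (x - H * Q * t) * (x - H' * Q * u) * (x / q * (K2 * X) / La * pm)
  + K1 * K2 * (x - L / Q * t) * (x - L' / Q * u) * (q * x * (K2^-1 * X) / La * pp)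
  - ((K1 + K2) * x ^+ 2 + - p * ((H'^-1 + L'^-1) * t + (H^-1 + L^-1) * u) * x
     + p * (Q + Q^-1) * t * u) * (x * X / La * p0)
  + (1 - La) * (L * L' * K1 / q) * t * u * (x * X) = 0.
Proof.
move=> x0 t0 u0 H0 H'0 L0 L'0 K0 La0 Q0 hq hK p a1 a2 a3 c1 c2 al be ga h.
transitivity (La * L * L' * K1 / Q ^+ 2 * t * u * x * X *
  (al * pm + be * pp - ga * p0 - (1 - a3 / q))); last by rewrite h subrr mulr0.
rewrite /ga /al /be /c1 /c2 /a1 /a2 /a3 /p hK -hq.
by field; rewrite ?x0 ?t0 ?u0 ?H0 ?H'0 ?L0 ?L'0 ?K0 ?La0 ?Q0.
Qed.

(** * Complex powers *)

Section Powers.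
Context {R : realType}.
Implicit Types (a b lq : R[i]).

Lemma cexpD a b : cexp (a + b) = cexp a * cexp b.
Proof.
case: a b => [a1 a2] [b1 b2]; rewrite /cexp /= expRD cosD sinD.
by apply/eqP; rewrite eq_complex /=; apply/andP; split; apply/eqP; ring.
Qed.

Lemma cexp0 : cexp (0 : R[i]) = 1.
Proof. by rewrite /cexp /= expR0 cos0 sin0 mulr1 mulr0. Qed.

Lemma qpowD lq a b : qpow lq (a + b) = qpow lq a * qpow lq b.
Proof. by rewrite /qpow mulrDl cexpD. Qed.

Lemma qpow0 lq : qpow lq 0 = 1.
Proof. by rewrite /qpow mul0r cexp0. Qed.

Lemma qpow_neq0 lq a : qpow lq a != 0.
Proof.
apply/eqP => h; have := qpow0 lq; rewrite -(subrr a) qpowD h mul0r.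
by move/esym/eqP; rewrite oner_eq0.
Qed.

Lemma qpowN lq a : qpow lq (- a) = (qpow lq a)^-1.
Proof.
apply: (mulIf (qpow_neq0 lq a)); rewrite mulVf ?qpow_neq0 //.
by rewrite -qpowD addNr qpow0.
Qed.

Lemma qpowB lq a b : qpow lq (a - b) = qpow lq a / qpow lq b.
Proof. by rewrite qpowD qpowN. Qed.

Lemma xpowD (L : R[i] -> R[i]) x a b :
  xpow L x (a + b) = xpow L x a * xpow L x b.
Proof. by rewrite /xpow mulrDl cexpD. Qed.

End Powers.

Lemma ord2_cases (i : 'I_2) : (i = 0 /\ rev_ord i = 1) \/ (i = 1 /\ rev_ord i = 0).
Proof. by case: i => [[|[|//]]] hi; [left|right]; split; exact: val_inj. Qed.

Section Equation.
Context {R : realType} (q lq : R[i]) (L : R[i] -> R[i]).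
Context (t h l : 'I_2 -> R[i]) (k1 k2 : R[i]).
Context (hlq : cexp lq = q).

Local Notation E := (qpow lq).
Local Notation Q := (E (1 / 2)).
Local Notation La := (E (lam h l k1 k2)).

Lemma qpow1 : E 1 = q. Proof. by rewrite /qpow mul1r. Qed.

Lemma qpow_half_sqr : Q ^+ 2 = q.
Proof. by rewrite expr2 -qpowD -qpow1; congr (E _); field. Qed.

Lemma qpow_three_halves : E (3 / 2) = Q ^+ 3.
Proof. by rewrite !exprS expr0 mulr1 -!qpowD; congr (E _); field. Qed.

Lemma qpow_k2 (i : 'I_2) : E k2 =
  La ^+ 2 * E (l i) * E (l (rev_ord i)) * E k1 /
    (E (h i) * E (h (rev_ord i)) * Q ^+ 2).
Proof.
rewrite !expr2 -!qpowD -qpowB; congr (E _); rewrite /lam.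
by case: (ord2_cases i) => -[-> ->]; field.
Qed.

Lemma pcoefE (i : 'I_2) : pcoef lq h l k1 k2 =
  La * E (l i) * E (l (rev_ord i)) * E k1 / Q.
Proof.
rewrite -!qpowD -qpowB /pcoef; congr (E _); rewrite /lam.
by case: (ord2_cases i) => -[-> ->]; field.
Qed.

Lemma xpow1D x a : cexp (L x) = x -> xpow L x (1 + a) = x * xpow L x a.
Proof. by move=> hx; rewrite xpowD {1}/xpow mul1r hx. Qed.

Lemma xpow_div x a : orbit_branch q lq L -> x != 0 ->
  xpow L (x / q) a = (E a)^-1 * xpow L x a.
Proof.
by move=> hL /hL [_ /(_ (- 1) a)]; rewrite exprN1 mulrC mulN1r qpowN => ->.
Qed.

Lemma xpow_mul x a : orbit_branch q lq L -> x != 0 ->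
  xpow L (q * x) a = E a * xpow L x a.
Proof. by move=> hL /hL [_ /(_ 1 a)]; rewrite expr1z mul1r => ->. Qed.

(** The equation is symmetric under the exchange of the two indices; listing i
    first lets [g_i] be treated for both i at once. *)
Lemma satisfies_at_from (i : 'I_2) (g : R[i] -> R[i]) (x : R[i]) :
  let H := E (h i) in let H' := E (h (rev_ord i)) in
  let M := E (l i) in let M' := E (l (rev_ord i)) in
  let s := t i in let u := t (rev_ord i) in
  let p := La * M * M' * E k1 / Q in
  cexp (L x) = x ->
  (x - H * Q * s) * (x - H' * Q * u) * g (x / q)
  + E k1 * E k2 * (x - M / Q * s) * (x - M' / Q * u) * g (q * x)
  - ((E k1 + E k2) * x ^+ 2
     + - p * ((H'^-1 + M'^-1) * s + (H^-1 + M^-1) * u) * x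
     + p * (Q + Q^-1) * s * u) * g x
  + (1 - La) * (M * M' * E k1 / q) * s * u * (x * xpow L x (- k2)) = 0 ->
  satisfies_at q lq L t h l k1 k2 g x.
Proof.
move=> H H' M M' s u p hx; rewrite /satisfies_at /Ecoef (pcoefE i).
rewrite (xpow1D x (- k2) hx) -/p !(qpowD, qpowN) qpow1 /H /H' /M /M' /s /u.
move: (g _) (g _) (g _) => g1 g2 g3; move: p (xpow _ _ _) => p X.
by case: (ord2_cases i) => -[-> ->] <-; ring.
Qed.

End Equation.

(** * The theorem *)

Theorem theorem4p6 (R : realType) (q lq : R[i]) (L : R[i] -> R[i])
    (t h l : 'I_2 -> R[i]) (k1 k2 : R[i])
    (hq0 : 0 < `|q|) (hq1 : `|q| < 1) (hlq : cexp lq = q)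
    (hL : orbit_branch q lq L)
    (ht0 : t 0 != 0) (ht1 : t 1 != 0) (ht : t 0 != t 1) :
  (forall (i : 'I_2) (x : R[i]), x != 0 ->
     g_i_defined q lq t h l k1 k2 i (x / q) ->
     g_i_defined q lq t h l k1 k2 i x ->
     g_i_defined q lq t h l k1 k2 i (q * x) ->
     satisfies_at q lq L t h l k1 k2 (g_i q lq L t h l k1 k2 i) x) /\
  (forall x : R[i], x != 0 ->
     g_0_defined q lq t h l k1 k2 (x / q) ->
     g_0_defined q lq t h l k1 k2 x ->
     g_0_defined q lq t h l k1 k2 (q * x) ->
     satisfies_at q lq L t h l k1 k2 (g_0 q lq L t h l k1 k2) x).
Proof.
have q0 : q != 0 by rewrite -normr_gt0.
have tn0 (i : 'I_2) : t i != 0 by case: (ord2_cases i) => -[-> _].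
have En0 a : qpow lq a != 0 by exact: qpow_neq0.
have Lx x : x != 0 -> cexp (L x) = x by move=> /hL [].
have xq0 x : x != 0 -> x / q != 0 by move=> x0; rewrite mulf_neq0 ?invr_eq0.
have qx0 x : x != 0 -> q * x != 0 by move=> x0; rewrite mulf_neq0.
have Q2 := qpow_half_sqr q lq hlq.
split=> [i x x0|x x0].
- have divx A : A / (x / q) = q * (A / x) by field; rewrite x0 q0.
  have mulx A : A / (q * x) = A / x / q by field; rewrite x0 q0.
  rewrite /g_i_defined /gi_args !divx !mulx.
  rewrite !(qpowD, qpowN) (qpow1 _ _ hlq) => dm d dp.
  have rel := nphi32_contiguous_a1c1 _ complex_geometric_complete q hq1
    _ _ _ _ _ q0 dm d dp.
  apply: (satisfies_at_from q lq L t h l k1 k2 hlq i _ x (Lx x x0)).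
  rewrite /g_i /gi_args !divx !mulx (xpow_div q lq) // (xpow_mul q lq) //.
  rewrite !(qpowD, qpowN) (qpow1 _ _ hlq) invrK.
  by apply: gi_algebra rel => //; exact: qpow_k2.
- have divx (A B : R[i]) : A * (x / q) / B = A * x / B / q by rewrite mulrA mulrAC.
  have mulx (A B : R[i]) : A * (q * x) / B = q * (A * x / B).
    by rewrite mulrCA !mulrA.
  have rev0 : rev_ord 0 = 1 :> 'I_2 by exact: val_inj.
  rewrite /g_0_defined /g0_args !divx !mulx.
  rewrite !(qpowD, qpowN) (qpow1 _ _ hlq) qpow_three_halves => dm d dp.
  have rel := nphi32_contiguous_a1a2c1c2 _ complex_geometric_complete q hq1
    _ _ _ _ _ q0 dm d dp.
  apply: (satisfies_at_from q lq L t h l k1 k2 hlq 0 _ x (Lx x x0)).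
  rewrite /g_0 /g0_args !divx !mulx.
  rewrite !xpow1D ?Lx ?xq0 ?qx0 // (xpow_div q lq) // (xpow_mul q lq) //.
  rewrite rev0 !(qpowD, qpowN) (qpow1 _ _ hlq) qpow_three_halves invrK.
  by apply: g0_algebra rel => //; rewrite (qpow_k2 lq h l k1 k2 0) rev0.
Qed.
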